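(* Let $G$ and $H$ be countable discrete groups, let $(X,\mu)$ be a standard probability space and let $(\mathsf{A},\mathsf{B})$ be an ergodic p.m.p. action of $G\times H$ on $(X,\mu)$. Then the synergodic decomposition of $(\mathsf{A},\mathsf{B})$ is isomorphic, as a factor of $(\mathsf{A},\mathsf{B})$, to the local product \[(\mathsf{E}_{\mathsf{A}\curvearrowright\mathsf{B}}) \boxdot (\mathsf{E}_{\mathsf{B}\curvearrowright\mathsf{A}}) \] acting on $(E_{\mathsf{A}}\times E_{\mathsf{B}},\eta_{\mathsf{A}}\times\eta_{\mathsf{B}})$.
   Context: All groups are countable and discrete. For a standard probability space $(X,\mu)$, $\mathcal{M}_X$ is the $\sigma$-algebra of measurable sets, $\mathcal{N}_X=\{D\in\mathcal{M}_X:\mu(D)\in\{0,1\}\}$, and $\mathrm{Aut}(X,\mu)$ is the group of measure-preserving transformations (identified when equal a.e.). A p.m.p. action of $G$ is a homomorphism $\mathsf{A}:G\to\mathrm{Aut}(X,\mu)$, $g\mapsto \mathsf{A}^g$. A p.m.p. action of $G\times H$ is written as a pair $(\mathsf{A},\mathsf{B})$ of commuting actions of $G$ and of $H$ on $(X,\mu)$. A set $D$ is $\mathsf{A}$-invariant if $\mu(\mathsf{A}^gD\triangle D)=0$ for all $g$; $\mathcal{E}_{\mathsf{A}}$ denotes the $\sigma$-algebra of $\mathsf{A}$-invariant sets; $\mathsf{A}$ is ergodic if $\mathcal{E}_{\mathsf{A}}=\mathcal{N}_X$. A factor map from $\mathsf{A}$ (on $(X,\mu)$) onto $\mathsf{C}$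 (on $(Y,\nu)$) is a measurable surjection $\Phi$ with $\Phi_\#\mu=\nu$ and $\Phi\circ\mathsf{A}^g=\mathsf{C}^g\circ\Phi$; a sub-$\sigma$-algebra $\mathcal{S}$ is $\mathsf{A}$-stable if $\{\mathsf{A}^g D : D \in \mathcal{S}\}=\mathcal{S}$ for all $g$, and every stable $\sigma$-algebra $\mathcal{S}$ has a realization, i.e. a factor $\Phi$ with $\mathcal{S}=\{\Phi^{-1}(D)\}$, unique up to isomorphism of factors (two factors $\Phi:X\to Y$, $\Omega:X\to Z$ are isomorphic as factors if there is an isomorphism $\Psi:Y\to Z$ of the factor actions with $\Psi\circ\Phi=\Omega$). The ergodic decomposition of $\mathsf{A}$ is the realization of $\mathcal{E}_{\mathsf{A}}$; its underlying space $(E_{\mathsf{A}},\eta_{\mathsf{A}})$ is the space of ergodic components of $\mathsf{A}$. For commuting $(\mathsf{A},\mathsf{B})$, $\mathcal{E}_{\mathsf{A}}$ is $\mathsf{B}$-stable, and $\mathsf{E}_{\mathsf{B}\curvearrowright\mathsf{A}}$ denotes the resulting factor action of $H$ on $(E_{\mathsf{A}},\eta_{\mathsf{A}})$; symmetrically $\mathsf{E}_{\mathsf{A}\curvearrowright\mathsf{B}}$ is the factor action of $G$ on $(E_{\mathsf{B}},\eta_{\mathsf{B}})$. The synergodic decomposition of $(\mathsf{A},\mathsf{B})$ is the factor of $(\mathsf{A},\mathsf{B})$ realizing the $\sigma$-algebra $\sigma(\mathcal{E}_{\mathsf{A}},\mathcal{E}_{\mathsf{B}})$ generated by $\mathcal{E}_{\mathsf{A}}$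 and $\mathcal{E}_{\mathsf{B}}$. For $\mathsf{C}$ a p.m.p. action of $G$ on $(Y,\nu)$ and $\mathsf{D}$ a p.m.p. action of $H$ on $(Z,\omega)$, the local product $\mathsf{C}\boxdot\mathsf{D}$ is the action of $G\times H$ on $(Y\times Z,\nu\times\omega)$ given by $(g,h)\cdot(y,z)=(\mathsf{C}^gy,\mathsf{D}^hz)$. *)

(* Defs.v *)
From HB Require Import structures.
From mathcomp Require Import all_boot all_order all_algebra.
From mathcomp Require Import all_classical all_reals all_analysis.
Set Implicit Arguments.
Unset Strict Implicit.
Unset Printing Implicit Defensive.
Import Order.TTheory GRing.Theory Num.Theory.
Local Open Scope classical_set_scope.
Local Open Scope ring_scope.

Definition symdiff (T : Type) (A B : set T) : set T := (A `\` B) `|` (B `\` A).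

(* Standard Borel space: measurably isomorphic to a Borel subset of the real
   line (Kuratowski: equivalently, to a Borel subset of a Polish space). *)
Definition standard_borel (R : realType) (d : measure_display) (X : measurableType d) : Prop :=
  exists f : X -> R,
    [/\ measurable_fun setT f, injective f, measurable (range f)
      & forall A, measurable A -> measurable (f @` A)].

Definition ae_eq_fun (R : realType) (d : measure_display) (X : measurableType d)
    (mu : set X -> \bar R) (Y : Type) (f g : X -> Y) : Prop :=
  {ae mu, forall x, f x = g x}.

Definition meas_pres (R : realType) (d d' : measure_display) (X : measurableType d)
    (Y : measurableType d') (mu : set X -> \bar R) (nu : set Y -> \bar R) (f : X -> Y) : Prop :=
  measurable_fun setT f /\ forall E, measurable E -> mu (f @^-1` E) = nu E.

(* A p.m.p. action of the group G on (X,mu): a homomorphism G -> Aut(X,mu),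
   given by measure-preserving representatives g |-> A g, the homomorphism
   identities holding mu-a.e. (elements of Aut(X,mu) are identified a.e.). *)
Definition pmp_action (R : realType) (G : groupType) (d : measure_display)
    (X : measurableType d) (mu : set X -> \bar R) (A : G -> X -> X) : Prop :=
  [/\ forall g, meas_pres mu mu (A g),
      ae_eq_fun mu (A 1%g) id
    & forall g h, ae_eq_fun mu (A (g * h)%g) (A g \o A h)].

Definition commuting (R : realType) (G H : groupType) (d : measure_display)
    (X : measurableType d) (mu : set X -> \bar R) (A : G -> X -> X) (B : H -> X -> X) : Prop :=
  forall g h, ae_eq_fun mu (A g \o B h) (B h \o A g).

Definition pmp_action2 (R : realType) (G H : groupType) (d : measure_display)
    (X : measurableType d) (mu : set X -> \bar R) (A : G -> X -> X) (B : H -> X -> X) : Prop :=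
  [/\ pmp_action mu A, pmp_action mu B & commuting mu A B].

(* D is A-invariant: mu(A^g D symdiff D) = 0 for all g (A^g D is written as the
   preimage (A^(g^-1))^-1(D); since g ranges over the whole group, this is the same). *)
Definition invariant_set (R : realType) (G : groupType) (d : measure_display)
    (X : measurableType d) (mu : set X -> \bar R) (A : G -> X -> X) (D : set X) : Prop :=
  measurable D /\ forall g, mu (symdiff (A g @^-1` D) D) = 0%E.

Definition invariant_sets (R : realType) (G : groupType) (d : measure_display)
    (X : measurableType d) (mu : set X -> \bar R) (A : G -> X -> X) : set (set X) :=
  [set D | invariant_set mu A D].

Definition ergodic2 (R : realType) (G H : groupType) (d : measure_display)
    (X : measurableType d) (mu : set X -> \bar R) (A : G -> X -> X) (B : H -> X -> X) : Prop :=
  forall D, invariant_set mu A D -> invariant_set mu B D -> mu D = 0%E \/ mu D = 1%E.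

Definition factor_map (R : realType) (G : groupType) (d d' : measure_display)
    (X : measurableType d) (Y : measurableType d') (mu : set X -> \bar R)
    (A : G -> X -> X) (nu : set Y -> \bar R) (C : G -> Y -> Y) (Phi : X -> Y) : Prop :=
  [/\ measurable_fun setT Phi, (forall y, exists x, Phi x = y),
      (forall E, measurable E -> mu (Phi @^-1` E) = nu E)
    & forall g, ae_eq_fun mu (Phi \o A g) (C g \o Phi)].

(* Phi realizes the sub-sigma-algebra S of M_X: S = {Phi^-1(D) : D in M_Y},
   as sigma-algebras of the measure algebra, i.e. modulo mu-null sets. *)
Definition realizes (R : realType) (d d' : measure_display) (X : measurableType d)
    (Y : measurableType d') (mu : set X -> \bar R) (S : set (set X)) (Phi : X -> Y) : Prop :=
  (forall D, S D -> exists E, measurable E /\ mu (symdiff D (Phi @^-1` E)) = 0%E) /\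
  (forall E, measurable E -> exists D, S D /\ mu (symdiff D (Phi @^-1` E)) = 0%E).

Definition action2_iso (R : realType) (G H : groupType) (d d' : measure_display)
    (Y : measurableType d) (Z : measurableType d')
    (nu : set Y -> \bar R) (C1 : G -> Y -> Y) (D1 : H -> Y -> Y)
    (om : set Z -> \bar R) (C2 : G -> Z -> Z) (D2 : H -> Z -> Z) (Psi : Y -> Z) : Prop :=
  [/\ meas_pres nu om Psi,
      (exists Psi' : Z -> Y, [/\ meas_pres om nu Psi',
                                 ae_eq_fun nu (Psi' \o Psi) id
                               & ae_eq_fun om (Psi \o Psi') id]),
      (forall g, ae_eq_fun nu (Psi \o C1 g) (C2 g \o Psi))
    & forall h, ae_eq_fun nu (Psi \o D1 h) (D2 h \o Psi)].

(* Local product C [.] D of a G-action C on Y and an H-action D on Z: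
   (g,h).(y,z) = (C^g y, D^h z); its G-part and H-part. *)
Definition lprodG (G : groupType) (Y Z : Type) (C : G -> Y -> Y) : G -> Y * Z -> Y * Z :=
  fun g p => (C g p.1, p.2).
Definition lprodH (H : groupType) (Y Z : Type) (D : H -> Z -> Z) : H -> Y * Z -> Y * Z :=
  fun h p => (p.1, D h p.2).

(* Main.v *)
Require Import Defs.
From HB Require Import structures.
From mathcomp Require Import all_boot all_order all_algebra.
From mathcomp Require Import all_classical all_reals all_analysis.
From mathcomp Require Import measurable_realfun charge.
Set Implicit Arguments.
Unset Strict Implicit.
Unset Printing Implicit Defensive.
Import Order.TTheory GRing.Theory Num.Theory.
Local Open Scope classical_set_scope.
Local Open Scope ring_scope.

(* For E in E_A and F in E_B, the finite signed measure
   D |-> mu(piA^-1 D `&` F) - mu(F) etaA(D) on the space of ergodic components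
   of A is invariant under the action of H, which is ergodic there because
   (A, B) is. A Hahn negative set can be made H-invariant, hence is null or
   conull, and since the total charge is 0 the charge vanishes. So E_A and E_B
   are independent and x |-> (piB x, piA x) has law etaB x etaA. As this map and
   Phi realize the same sigma-algebra modulo null sets and their targets are
   standard Borel, each factors through the other almost everywhere. *)

(** * Equality of sets modulo null sets, and its transport along maps *)

Lemma measurable_preimage d d' (X : measurableType d) (Y : measurableType d')
    (f : X -> Y) (E : set Y) :
  measurable_fun setT f -> measurable E -> measurable (f @^-1` E).
Proof. by move=> mf mE; rewrite -[X in measurable X]setTI; exact: mf. Qed.

(** Stated pointwise through the almost-everywhere filter, so that set operations and preimages need
    no measurability; [ae_eq_setP] links it to null symmetric differences. *)
Definition ae_eq_set (R : realType) d (X : measurableType d)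
    (mu : set X -> \bar R) (A B : set X) : Prop := {ae mu, forall x, A x <-> B x}.

Section ae_sets.
Context (R : realType) d (X : measurableType d) (mu : {measure set X -> \bar R}).
Implicit Types A B C : set X.

Lemma setC_iff_symdiff A B : ~` [set x | A x <-> B x] = symdiff A B.
Proof.
apply/seteqP; split=> x /=.
  move=> nAB; have [Ax|nAx] := pselect (A x); have [Bx|nBx] := pselect (B x).
  - by case: nAB.
  - by left.
  - by right.
  - by case: nAB.
by rewrite /symdiff /= => -[[Ax nBx] [AB _]|[Bx nAx] [_ BA]]; auto.
Qed.

Lemma ae_eq_setP A B : measurable A -> measurable B ->
  mu (symdiff A B) = 0%E <-> ae_eq_set mu A B.
Proof.
move=> mA mB; rewrite /ae_eq_set /prop_near1 /nbhs /= /almost_everywhere.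
rewrite setC_iff_symdiff negligibleP //.
by apply: measurableU; exact: measurableD.
Qed.

Lemma ae_eq_set_sym A B : ae_eq_set mu A B -> ae_eq_set mu B A.
Proof. by rewrite /ae_eq_set; apply: filterS => x ->. Qed.

Lemma ae_eq_set_trans A B C :
  ae_eq_set mu A B -> ae_eq_set mu B C -> ae_eq_set mu A C.
Proof. by rewrite /ae_eq_set; apply: filterS2 => x -> ->. Qed.

Lemma ae_eq_setC A B : ae_eq_set mu A B -> ae_eq_set mu (~` A) (~` B).
Proof.
by rewrite /ae_eq_set; apply: filterS => x AB; split=> nx y; apply: nx; exact/AB.
Qed.

Lemma ae_eq_setI A B A' B' : ae_eq_set mu A B -> ae_eq_set mu A' B' ->
  ae_eq_set mu (A `&` A') (B `&` B').
Proof.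
rewrite /ae_eq_set; apply: filterS2 => x [? ?] [? ?].
by split=> -[? ?]; split; auto.
Qed.

Lemma measure_ae_sub A B : measurable A -> measurable B ->
  {ae mu, forall x, A x -> B x} -> (mu A <= mu B)%E.
Proof.
move=> mA mB AB; have mAB := measurableD mA mB.
have AB0 : mu (A `\` B) = 0%E.
  apply/(negligibleP mu mAB); apply: negligibleS AB => x [Ax nBx] /= AB.
  exact/nBx/AB.
have -> : mu A = (mu (A `\` B) + mu (A `&` B))%E by exact: measureDI.
by rewrite AB0 add0e setIC; exact: measureIl.
Qed.

Lemma measure_ae_eq A B : measurable A -> measurable B ->
  ae_eq_set mu A B -> mu A = mu B.
Proof.
move=> mA mB AB; apply/eqP; rewrite eq_le !measure_ae_sub//;
  by move: AB; rewrite /ae_eq_set; apply: filterS => x ->.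
Qed.

End ae_sets.

Section ae_countable.
Context (R : realType) d (X : measurableType d) (mu : {measure set X -> \bar R}).

Lemma ae_forall_countable (I : Type) (P : I -> X -> Prop) :
  countable [set: I] -> (forall i, {ae mu, forall x, P i x}) ->
  {ae mu, forall x, forall i, P i x}.
Proof.
move=> /countable_injP[f finj] aeP.
have : {ae mu, forall x, forall n i, f i = n -> P i x}.
  apply: ae_foralln => n; have [[i fi]|nofi] := pselect (exists i, f i = n).
    move: (aeP i); apply: filterS => x Pix j fj.
    by rewrite (finj j i) ?inE ?fj ?fi.
  by apply: aeW => x i fi; case: nofi; exists i.
by apply: filterS => x Px i; exact: Px.
Qed.

End ae_countable.

Section ae_transfer.
Context (R : realType) d d' (X : measurableType d) (Y : measurableType d').
Context (mu : {measure set X -> \bar R}) (nu : {measure set Y -> \bar R}).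
Context (f : X -> Y) (fmp : meas_pres mu nu f).

Lemma ae_meas_pres (P : Y -> Prop) :
  {ae nu, forall y, P y} -> {ae mu, forall x, P (f x)}.
Proof.
case: fmp => mf fE [N [mN N0 sub]]; exists (f @^-1` N); split.
- exact: measurable_preimage.
- by have -> : mu (f @^-1` N) = nu N by exact: fE.
- by move=> x /= nP; apply: sub.
Qed.

(** Measurability lets the exceptional set itself be measured upstairs through [f]. *)
Lemma ae_meas_pres_inv (P : Y -> Prop) : measurable [set y | P y] ->
  {ae mu, forall x, P (f x)} -> {ae nu, forall y, P y}.
Proof.
case: fmp => mf fE mP; have mCP := measurableC mP => aeP.
have nu0 : nu (~` [set y | P y]) = 0%E.
  rewrite -fE//.
  exact/(negligibleP mu (measurable_preimage mf mCP)).
exact/(negligibleP nu mCP).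
Qed.

End ae_transfer.

(** * Maps into standard Borel spaces *)

Section standard_borel.
Context (R : realType) d (Z : measurableType d) (stdZ : standard_borel R Z).

Lemma standard_borel_eq_measurable d' (Y : measurableType d') (u v : Y -> Z) :
  measurable_fun setT u -> measurable_fun setT v ->
  measurable [set y | u y = v y].
Proof.
case: stdZ => f [mf finj _ _] mu mv.
have := measurable_fun_eqr (measurableT_comp mf mu) (measurableT_comp mf mv).
move=> /(_ measurableT [set true] I); rewrite setTI; congr (measurable _).
apply/seteqP; split=> y /=; first by move=> /eqP /finj. 
by move=> ->; rewrite eqxx.
Qed.

(** The sublevel sets of the embedding [f] at rationals suffice: off one null set no rational
    separates [f (u x)] from [f (v x)]. *)
Lemma ae_eq_fun_preimages d' (X : measurableType d')
    (mu : {measure set X -> \bar R}) (u v : X -> Z) :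
  (forall E, measurable E -> ae_eq_set mu (u @^-1` E) (v @^-1` E)) ->
  ae_eq_fun mu u v.
Proof.
case: stdZ => f [mf finj _ _] uv.
have : {ae mu, forall x, forall q : rat, f (u x) < ratr q <-> f (v x) < ratr q}.
  apply: ae_forall_countable => [|q]; first exact: countableP.
  have mq : measurable (f @^-1` `]-oo, ratr q[%classic).
    by apply: measurable_preimage => //; exact: measurable_itv.
  by move: (uv _ mq); rewrite /ae_eq_set; apply: filterS => x; rewrite /= !in_itv.
apply: filterS => x uvx; apply: finj.
have [lt|lt|//] := ltgtP (f (u x)) (f (v x)).
  have [q] := rat_in_itvoo lt; rewrite in_itv/= => /andP[/uvx uq vq].
  by move: (lt_trans uq vq); rewrite ltxx.
have [q] := rat_in_itvoo lt; rewrite in_itv/= => /andP[/uvx uq vq].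
by move: (lt_trans uq vq); rewrite ltxx.
Qed.

(** Lets an identity between maps on the factor [Y] be checked upstairs on [X]. *)
Lemma ae_eq_fun_meas_pres d1 d2 (X : measurableType d1) (Y : measurableType d2)
    (mu : {measure set X -> \bar R}) (nu : {measure set Y -> \bar R})
    (p : X -> Y) (u v : Y -> Z) :
  meas_pres mu nu p -> measurable_fun setT u -> measurable_fun setT v ->
  ae_eq_fun mu (u \o p) (v \o p) -> ae_eq_fun nu u v.
Proof.
move=> pmp mu' mv uv; apply: (ae_meas_pres_inv pmp) => //.
exact: standard_borel_eq_measurable.
Qed.

End standard_borel.

(** * Factoring one map through another modulo null sets *)

Lemma measurable_ereal_inf_rat (R : realType) d (S : measurableType d)
    (F : rat -> set S) : (forall q, measurable (F q)) ->
  measurable_fun setT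
    (fun s => ereal_inf [set (ratr q)%:E | q in [set q | F q s]] : \bar R).
Proof.
move=> mF mT; apply: (measurability _ (ErealGenInftyO.measurableE R)) => //.
move=> _ [_ [r ->] <-]; rewrite setTI.
rewrite (_ : _ @^-1` _ =
    \bigcup_q (if (ratr q : R) < r then F q else set0)); last first.
  apply/seteqP; split=> s /=; rewrite in_itv/=.
    move=> /ereal_inf_lt[_ [q /= Fqs <-]]; rewrite lte_fin => qr.
    by exists q => //; rewrite qr.
  move=> [q _]; case: ifPn => // qr Fqs.
  apply: (@le_lt_trans _ _ (ratr q)%:E); last by rewrite lte_fin.
  by apply: ereal_inf_lbound; exists q.
by apply: bigcupT_measurable_rat => q; case: ifP.
Qed.

Section factorization.
Context (R : realType) d d1 d2 (X : measurableType d) (S : measurableType d1)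
  (T : measurableType d2) (mu : {measure set X -> \bar R}).

(** The Doob-Dynkin lemma modulo null sets: the sublevel sets of [f \o g] at rationals come from
    sets [F q] in [S], and these determine [g] almost everywhere. *)
Lemma measurable_factor_ae (p : X -> S) (g : X -> T) (t0 : T) :
  standard_borel R T ->
  (forall E, measurable E ->
    exists2 F, measurable F & ae_eq_set mu (g @^-1` E) (p @^-1` F)) ->
  exists2 psi : S -> T, measurable_fun setT psi & ae_eq_fun mu (psi \o p) g.
Proof.
move=> [f [mf finj mrf imf]] gp.
have mfq (q : rat) : measurable (f @^-1` `]-oo, (ratr q : R)[%classic).
  by apply: measurable_preimage => //; exact: measurable_itv.
have /choice[F FP] : forall q : rat, exists F, measurable F /\
    ae_eq_set mu (g @^-1` (f @^-1` `]-oo, (ratr q : R)[%classic)) (p @^-1` F).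
  by move=> q; have [F mF gF] := gp _ (mfq q); exists F.
(* [k] recovers [f \o g] from the sublevel sets [F q]; [inv] is the inverse of
   [f] extended by [t0] outside its Borel range. *)
pose k s : \bar R := ereal_inf [set (ratr q)%:E | q in [set q | F q s]].
have mk : measurable_fun setT k.
  by apply: measurable_ereal_inf_rat => q; have [] := FP q.
have kp : {ae mu, forall x, k (p x) = (f (g x))%:E}.
  have : {ae mu, forall x, forall q : rat, f (g x) < ratr q <-> F q (p x)}.
    apply: ae_forall_countable => [|q]; first exact: countableP.
    by have [_] := FP q; rewrite /ae_eq_set; apply: filterS => x; rewrite /= in_itv.
  apply: filterS => x gF; apply/eqP; rewrite eq_le; apply/andP; split.
    apply/lee_addgt0Pr => e e0.
    have [q] := rat_in_itvoo (ltr_pwDr e0 (lexx (f (g x)))).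
    rewrite in_itv/= => /andP[/gF Fq qe].
    apply: (@le_trans _ _ (ratr q)%:E); first by apply: ereal_inf_lbound; exists q.
    by rewrite -EFinD lee_fin ltW.
  by apply: le_ereal_inf_tmp => _ [q /= /gF gq <-]; rewrite lee_fin ltW.
pose inv (y : \bar R) : T := if pselect (exists t, (f t)%:E = y) is left e
  then projT1 (cid e) else t0.
have invK t : inv (f t)%:E = t.
  rewrite /inv; case: pselect => [e|[]]; last by exists t.
  by case: cid => t' /= [] /finj.
have minv : measurable_fun setT inv.
  move=> _ E mE; rewrite setTI.
  (* Points outside the range of [f] all go to [t0], hence count only when [t0] is in [E]. *)
  rewrite (_ : _ @^-1` _ = (EFin @` (f @` E)) `|`
     (if `[< E t0 >] then ~` (EFin @` range f) else set0)).
    apply: measurableU; first by apply: measurable_image_EFin; exact: imf.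
    case: asboolP => // _; apply: measurableC.
    exact: measurable_image_EFin.
  apply/seteqP; split=> y /=.
    have [[t <-]|nt] := pselect (exists t, (f t)%:E = y).
      by rewrite invK => Et; left; exists (f t) => //; exists t.
    rewrite /inv; case: pselect => // _ Et0; right; case: asboolP => //= _.
    by move=> [_ [t _ <-] ty]; apply: nt; exists t.
  move=> [[_ [t Et <-] <-]|]; first by rewrite invK.
  case: asboolP => // Et0 nr; rewrite /inv; case: pselect => // -[t ty].
  by case: nr; exists (f t) => //; exists t.
exists (inv \o k); first exact: measurableT_comp.
by rewrite /ae_eq_fun /=; apply: filterS kp => x ->; rewrite invK.
Qed.

End factorization.

(** * Invariant charges for an ergodic action *)

Section ergodic_charge.
Context (R : realType) (H : groupType) d (Y : measurableType d).
Context (eta : {measure set Y -> \bar R}) (sigma : {charge set Y -> \bar R}).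
Hypothesis sigma_dom : forall E, measurable E -> eta E = 0%E -> sigma E = 0%E.

(** Apart from their intersection, [A] and [B] consist of [eta]-null differences, which have charge
    zero by absolute continuity. *)
Lemma charge_ae_eq A B : measurable A -> measurable B ->
  ae_eq_set eta A B -> sigma A = sigma B.
Proof.
have diff0 C D : measurable C -> measurable D ->
    {ae eta, forall x, C x -> D x} -> sigma (C `\` D) = 0%E.
  move=> mC mD CD; have mCD := measurableD mC mD.
  apply: sigma_dom => //; apply/(negligibleP eta mCD).
  by apply: negligibleS CD => x [Cx nDx] /= /(_ Cx).
move=> mA mB AB; rewrite (chargeDI sigma mA mB) (chargeDI sigma mB mA).
by rewrite setIC !diff0//; move: AB; rewrite /ae_eq_set; apply: filterS => x ->.
Qed.

Context (T : H -> Y -> Y) (actT : pmp_action eta T).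
Hypothesis countH : countable [set: H].
Hypothesis sigma_inv :
  forall h E, measurable E -> sigma (T h @^-1` E) = sigma E.

Let mT h E : measurable E -> measurable (T h @^-1` E).
Proof. by case: actT => /(_ h)[mTh _] _ _; exact: measurable_preimage. Qed.

Let TM g h E : measurable E ->
  ae_eq_set eta (T h @^-1` (T g @^-1` E)) (T (g * h)%g @^-1` E).
Proof.
case: actT => _ _ /(_ g h); rewrite /ae_eq_fun /ae_eq_set => + _.
by apply: filterS => y /= ->.
Qed.

Let T1 E : ae_eq_set eta (T 1%g @^-1` E) E.
Proof.
case: actT => _ + _; rewrite /ae_eq_fun /ae_eq_set.
by apply: filterS => y /= ->.
Qed.

(* A subset of T_h^-1(N) is carried into N, up to a null set, by the inverse
   of T_h, and this does not change its charge. *)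
Lemma negative_set_preimage (N : set Y) (h : H) :
  negative_set sigma N -> negative_set sigma (T h @^-1` N).
Proof.
move=> [mN negN]; split=> [|E mE EN]; first exact: mT.
rewrite -(sigma_inv (h^-1)%g mE).
have mE' := mT (h^-1)%g mE.
rewrite (@charge_ae_eq _ ((T (h^-1)%g @^-1` E) `&` N)) //.
- by apply: negN; [exact: measurableI|exact: subIsetr].
- exact: measurableI.
- have := ae_eq_set_trans (TM h (h^-1)%g mN) _; rewrite mulgV => /(_ _ (T1 N)).
  rewrite /ae_eq_set; apply: filterS => y /= TN; split => [Ey|[]//].
  by split => //; apply/TN; exact: EN.
Qed.

Hypothesis ergT : forall E, measurable E ->
  (forall h, ae_eq_set eta (T h @^-1` E) E) -> eta E = 0%E \/ eta (~` E) = 0%E.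

Lemma ergodic_charge_eq0 : sigma setT = 0%E ->
  forall E, measurable E -> sigma E = 0%E.
Proof.
move=> sigmaT.
have [P [N [[mP posP] negN PN PN0]]] := Hahn_decomposition sigma.
have [mN _] := negN.
(* A charge of constant sign and total zero vanishes: [E] and its complement have charges of the
   same sign that add up to zero. The boolean [s] selects the sign. *)
have eq0 (s : bool) : (forall E, measurable E ->
      if s then (0 <= sigma E)%E else (sigma E <= 0)%E) ->
    forall E, measurable E -> sigma E = 0%E.
  move=> sgn E mE; have mCE := measurableC mE.
  have : (sigma E + sigma (~` E) == 0)%E.
    by rewrite -chargeU ?setICr// setUCr sigmaT.
  rewrite adde_ss_eq0; first by move=> /andP[/eqP].
  by have := sgn _ mE; have := sgn _ mCE; case: s {sgn} => -> ->; rewrite ?orbT.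
(* [e] enumerates [H], with [1] as the value at integers that code no element. *)
have [e esurj] : exists e : nat -> H, forall h, exists n, e n = h.
  have [f finj] := countable_injP _ countH.
  exists (fun n => if pselect (exists h, f h = n) is left nh
    then projT1 (cid nh) else 1%g).
  move=> h; exists (f h); case: pselect => [nh|[]]; last by exists h.
  by case: cid => h' /= /finj; rewrite !inE; apply.
(* Saturating [N] under [H] keeps it negative, as the union is countable, and makes it invariant
   modulo null sets, as a translation only permutes the pieces. *)
pose Q := \bigcup_n (T (e n) @^-1` N).
have negQ : negative_set sigma Q.
  by apply: bigcup_negative_set => n; exact: negative_set_preimage.
have [mQ _] := negQ.
have Qinv h : ae_eq_set eta (T h @^-1` Q) Q.
  have : {ae eta, forall y, forall n,
      (T (e n) @^-1` N) (T h y) <-> (T (e n * h)%g @^-1` N) y}.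
    by apply: ae_foralln => n; exact: TM.
  rewrite /ae_eq_set; apply: filterS => y TMy; split.
    move=> [n _ /TMy Ty]; have [m em] := esurj (e n * h)%g.
    by exists m => //; rewrite em.
  move=> [n _ Ty]; have [m em] := esurj (e n * h^-1)%g.
  by exists m => //; apply/TMy; rewrite em mulgVK.
(* If [Q] is null, so is its piece [N] at the identity, and every set lies almost everywhere in the
   positive set [P]; if [Q] is conull, every set has charge at most zero. *)
case: (ergT mQ Qinv) => [Q0|Q1].
  apply: (eq0 true) => E mE.
  have N0 : eta N = 0%E.
    have [m em] := esurj 1%g; apply/eqP; rewrite -measure_le0 -Q0.
    apply: measure_ae_sub => //; move: (T1 N).
    by rewrite /ae_eq_set; apply: filterS => y TN Ny; exists m; rewrite ?em //; exact/TN.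
  rewrite (@charge_ae_eq _ (E `&` P)) //.
  - by apply: posP; [exact: measurableI|exact: subIsetr].
  - exact: measurableI.
  - have : {ae eta, forall y, ~ N y} by exists N; split => // y /= /contrapT.
    rewrite /ae_eq_set; apply: filterS => y nNy; split => [Ey|[]//]; split => //.
    by have : [set: Y] y by []; rewrite -PN => -[].
apply: (eq0 false) => E mE.
rewrite (@charge_ae_eq _ (E `&` Q)) //.
- by case: negQ => _; apply; [exact: measurableI|exact: subIsetr].
- exact: measurableI.
- have : {ae eta, forall y, Q y}.
    exact/(negligibleP eta (measurableC mQ)).
  rewrite /ae_eq_set; apply: filterS => y Qy; split=> [Ey|[]//]; split => //.
Qed.

End ergodic_charge.

(** * Invariant sets and the independence of the two ergodic decompositions *)

Section invariant_sets.
Context (R : realType) (G : groupType) d (X : measurableType d).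
Context (mu : {measure set X -> \bar R}) (A : G -> X -> X).
Hypothesis actA : pmp_action mu A.

Lemma pmp_action_meas_pres g : meas_pres mu mu (A g).
Proof. by case: actA. Qed.

Lemma invariant_setP D : measurable D ->
  invariant_set mu A D <-> forall g, ae_eq_set mu (A g @^-1` D) D.
Proof.
move=> mD; have mAD g : measurable (A g @^-1` D).
  by have [mA _] := pmp_action_meas_pres g; exact: measurable_preimage.
split=> [[_ AD] g|AD]; first exact/ae_eq_setP.
by split=> // g; exact/ae_eq_setP.
Qed.

(** Such a preimage is only almost equal to a set of the realized family; invariance survives
    because [A g] preserves [mu]. *)
Lemma realizes_invariant d' (Y : measurableType d') (p : X -> Y) :
  measurable_fun setT p -> realizes mu (invariant_sets mu A) p ->
  forall E, measurable E -> invariant_set mu A (p @^-1` E).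
Proof.
move=> mp [_ rA] E mE; have mpE := measurable_preimage mp mE.
apply/(invariant_setP mpE) => g.
have [D [Dinv]] := rA _ mE; have mD := Dinv.1.
move=> /(ae_eq_setP mu mD mpE) DE.
have /(invariant_setP mD)/(_ g) AD := Dinv.
apply: ae_eq_set_trans (DE); apply: ae_eq_set_trans (AD).
apply: ae_eq_set_sym; exact: (ae_meas_pres (pmp_action_meas_pres g) DE).
Qed.

End invariant_sets.

Section independence.
Context (R : realType) (G H : groupType) d (X : measurableType d).
Context (mu : probability X R) (A : G -> X -> X) (B : H -> X -> X).
Hypothesis countH : countable [set: H].
Hypotheses (actA : pmp_action mu A) (actB : pmp_action mu B).
Hypothesis ergAB : ergodic2 mu A B.
Context d' (Y : measurableType d') (eta : probability Y R).
Context (p : X -> Y) (C : H -> Y -> Y) (actC : pmp_action eta C).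
Hypotheses (pB : factor_map mu B eta C p)
  (pA : realizes mu (invariant_sets mu A) p).

Let mp : measurable_fun setT p. Proof. by case: pB. Qed.

Lemma factor_map_preimage h E : measurable E ->
  ae_eq_set mu (B h @^-1` (p @^-1` E)) (p @^-1` (C h @^-1` E)).
Proof.
case: pB => _ _ _ /(_ h) + _; rewrite /ae_eq_fun /ae_eq_set.
by apply: filterS => x /= ->.
Qed.

Let factor_mp : meas_pres mu eta p. Proof. by case: pB. Qed.

(** The preimage of [E] is [A]-invariant by realization and [B]-invariant by equivariance, so joint
    ergodicity applies. *)
Lemma ergodic_components_action_ergodic E : measurable E ->
  (forall h, ae_eq_set eta (C h @^-1` E) E) -> eta E = 0%E \/ eta (~` E) = 0%E.
Proof.
move=> mE EC; have mpE := measurable_preimage mp mE.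
have pE : mu (p @^-1` E) = eta E by exact: factor_mp.2.
case: (ergAB (realizes_invariant actA mp pA mE)).
- apply/(invariant_setP actB mpE) => h.
  apply: ae_eq_set_trans (factor_map_preimage h mE) _.
  exact: (ae_meas_pres factor_mp (EC h)).
- by move=> pE0; left; rewrite -pE.
- by move=> pE1; right; rewrite probability_setC// -pE pE1 subee.
Qed.

Lemma invariant_sets_independent (F : set X) (E : set Y) :
  invariant_set mu B F -> measurable E ->
  mu (p @^-1` E `&` F) = (eta E * mu F)%E.
Proof.
move=> Finv mE; have mF := Finv.1.
have mpE D : measurable D -> measurable (p @^-1` D) by exact: measurable_preimage.
have pE D : measurable D -> mu (p @^-1` D) = eta D by move=> mD; exact: factor_mp.2.
(* The charge is the pushforward along [p] of [mu] restricted to [F], plus [eta] scaled by minus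
   [mu F]. *)
have [sigma sigmaE] : exists sigma : {charge set Y -> \bar R}, forall D,
    measurable D -> sigma D = (mu (p @^-1` D `&` F) - mu F * eta D)%E.
  pose s1 : {charge set X -> \bar R} := charge_of_finite_measure mu.
  pose s2 : {charge set X -> \bar R} := crestr0 s1 mF.
  pose s3 : {charge set Y -> \bar R} :=
    measure_function_pushforward__canonical__charge_Charge s2 mp.
  pose s4 : {charge set Y -> \bar R} :=
    cscale (- fine (mu F)) (charge_of_finite_measure eta).
  exists (cadd s3 s4) => D mD.
  have s3D : s3 D = mu (p @^-1` D `&` F).
    change (crestr0 s1 mF (p @^-1` D) = mu (p @^-1` D `&` F)).
    by rewrite /crestr0 mem_set//; exact: mpE.
  have s4D : s4 D = (- (mu F * eta D))%E.
    change ((- fine (mu F))%:E * eta D = - (mu F * eta D))%E.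
    by rewrite EFinN fineK ?mulNe//; exact: fin_num_measure.
  by change (s3 D + s4 D = mu (p @^-1` D `&` F) - mu F * eta D)%E; rewrite s3D s4D.
suff : sigma E = 0%E.
  rewrite sigmaE// => /eqP; rewrite sube_eq ?add0e; last 2 first.
  - by apply: fin_num_measure; apply: measurableI => //; exact: mpE.
  - by rewrite fin_num_adde_defl// fin_numM//; exact: fin_num_measure.
  by rewrite muleC => /eqP.
apply: (ergodic_charge_eq0 (eta := eta) _ actC countH) => //.
- move=> D mD D0; rewrite sigmaE// D0 mule0 sube0.
  have D0' : mu (p @^-1` D) = 0%E by rewrite pE.
  apply/eqP; rewrite -measure_le0 -D0'; apply: measureIl => //; exact: mpE.
- move=> h D mD; have [mCh CD] := pmp_action_meas_pres actC h.
  have mCD := measurable_preimage mCh mD.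
  rewrite !sigmaE// CD//; congr (_ - _)%E.
  have [mBh BD] := pmp_action_meas_pres actB h.
  (* Up to null sets, pulling back by [B h] fixes [F] and replaces [D] by its preimage under [C h];
     it also preserves [mu]. *)
  rewrite -(BD (p @^-1` D `&` F)); last by apply: measurableI => //; exact: mpE.
  apply: measure_ae_eq.
  + by apply: measurableI => //; exact: mpE.
  + by apply: measurable_preimage => //; apply: measurableI => //; exact: mpE.
  + apply: ae_eq_setI; first exact/ae_eq_set_sym/factor_map_preimage.
    by apply/ae_eq_set_sym; move: h {mCh CD mCD mBh BD}; exact/(invariant_setP actB mF).
- exact: ergodic_components_action_ergodic.
- rewrite sigmaE// preimage_setT setTI !probability_setT mule1 subee//.
  exact: fin_num_measure.
Qed.

End independence.

(** * Generated sigma-algebras, factors and the product map *)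

(** The sets matched by some preimage form a sigma-algebra, since countably many null sets have null
    union. *)
Lemma generated_sigma_algebra_ae_preimage (R : realType) d d' (X : measurableType d)
    (T : measurableType d') (mu : {measure set X -> \bar R}) (p : X -> T)
    (K : set (set X)) :
  (forall D, K D -> exists2 F, measurable F & ae_eq_set mu D (p @^-1` F)) ->
  forall D, <<s K >> D -> exists2 F, measurable F & ae_eq_set mu D (p @^-1` F).
Proof.
move=> KP; apply: smallest_sub => //; split.
- by exists set0 => //; apply: aeW.
- move=> D [F mF DF]; exists (~` F); first exact: measurableC.
  by rewrite setTD; exact: ae_eq_setC.
- move=> D DP; have /choice[F FP] : forall n, exists F,
      measurable F /\ ae_eq_set mu (D n) (p @^-1` F).
    by move=> n; have [F mF DF] := DP n; exists F.
  exists (\bigcup_n F n); first by apply: bigcupT_measurable => n; case: (FP n).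
  have : {ae mu, forall x, forall n, D n x <-> (p @^-1` F n) x}.
    by apply: ae_foralln => n; case: (FP n).
  rewrite /ae_eq_set; apply: filterS => x DFx.
  by split=> -[n _ /DFx]; exists n.
Qed.

Section factors.
Context (R : realType) d d1 d2 (X : measurableType d) (Y : measurableType d1)
  (Z : measurableType d2) (mu : {measure set X -> \bar R})
  (nu : {measure set Y -> \bar R}).

Lemma meas_pres_factor (om : {measure set Z -> \bar R}) (p : X -> Y) (g : X -> Z)
    (psi : Y -> Z) :
  meas_pres mu nu p -> meas_pres mu om g -> measurable_fun setT psi ->
  ae_eq_fun mu (psi \o p) g -> meas_pres nu om psi.
Proof.
move=> [mp pE] [mg gE] mpsi psig; split=> // E mE.
have mpsiE := measurable_preimage mpsi mE.
rewrite -pE// -gE//; apply: measure_ae_eq; try exact: measurable_preimage.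
by move: psig; rewrite /ae_eq_fun /ae_eq_set; apply: filterS => x /= ->.
Qed.

(** Done coordinatewise, which asks standardness of the factors [Z] and [W] rather than of their
    product. *)
Lemma ae_eq_fun_meas_pres_pair d3 (W : measurableType d3) (p : X -> Y)
    (u v : Y -> Z * W) :
  standard_borel R Z -> standard_borel R W ->
  meas_pres mu nu p -> measurable_fun setT u -> measurable_fun setT v ->
  ae_eq_fun mu (u \o p) (v \o p) -> ae_eq_fun nu u v.
Proof.
move=> stdZ stdW pmp mu' mv uv.
have mfst (w : Y -> Z * W) : measurable_fun setT w -> measurable_fun setT (fst \o w).
  by move=> mw; apply: measurableT_comp mw.
have msnd (w : Y -> Z * W) : measurable_fun setT w -> measurable_fun setT (snd \o w).
  by move=> mw; apply: measurableT_comp mw.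
have uv1 : ae_eq_fun nu (fst \o u) (fst \o v).
  apply: (ae_eq_fun_meas_pres stdZ pmp); [exact: mfst|exact: mfst|].
  by move: uv; rewrite /ae_eq_fun; apply: filterS => x /= ->.
have uv2 : ae_eq_fun nu (snd \o u) (snd \o v).
  apply: (ae_eq_fun_meas_pres stdW pmp); [exact: msnd|exact: msnd|].
  by move: uv; rewrite /ae_eq_fun; apply: filterS => x /= ->.
move: uv1 uv2; rewrite /ae_eq_fun; apply: filterS2 => y /=.
by case: (u y) (v y) => a b [a' b'] /= -> ->.
Qed.

End factors.

(** Every set pulled back by [p] is invariant, and such sets determine [p] almost everywhere because
    [Y] is standard. *)
Lemma invariant_ae_fun (R : realType) (G : groupType) d d' (X : measurableType d)
    (Y : measurableType d') (mu : {measure set X -> \bar R}) (A : G -> X -> X)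
    (p : X -> Y) (g : G) :
  standard_borel R Y -> pmp_action mu A -> measurable_fun setT p ->
  realizes mu (invariant_sets mu A) p -> ae_eq_fun mu (p \o A g) p.
Proof.
move=> stdY actA mp rA; apply: (ae_eq_fun_preimages stdY) => E mE.
have mpE := measurable_preimage mp mE.
by have /(invariant_setP actA mpE) := realizes_invariant actA mp rA mE; exact.
Qed.

(** A product measure is determined by rectangles, and on these the claim is the independence of
    [A]-invariant and [B]-invariant sets. *)
Lemma synergodic_product_meas_pres (R : realType) (G H : groupType) d
    (X : measurableType d) (mu : probability X R) (A : G -> X -> X) (B : H -> X -> X)
    dA (EA : measurableType dA) (etaA : probability EA R)
    dB (EB : measurableType dB) (etaB : probability EB R)
    (piA : X -> EA) (piB : X -> EB) (BA : H -> EA -> EA) :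
  countable [set: H] -> pmp_action mu A -> pmp_action mu B -> ergodic2 mu A B ->
  pmp_action etaA BA -> factor_map mu B etaA BA piA ->
  realizes mu (invariant_sets mu A) piA ->
  meas_pres mu etaB piB -> realizes mu (invariant_sets mu B) piB ->
  meas_pres mu (etaB \x etaA)%E (fun x => (piB x, piA x)).
Proof.
move=> cH actA actB ergAB actBA fBA rA [mB muB] rB.
have [mA _ muA _] := fBA.
have mBA : measurable_fun setT (fun x => (piB x, piA x)).
  exact: measurable_fun_pair.
split=> // E mE; apply/esym.
pose m' : {measure set (EB * EA) -> \bar R} :=
  measure_function_pushforward__canonical__measure_function_Measure mu mBA.
apply: (product_measure_unique (m' := m')) => // F D mF mD.
change (mu (piB @^-1` F `&` piA @^-1` D) = etaB F * etaA D)%E.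
rewrite setIC (invariant_sets_independent cH actA actB ergAB actBA fBA rA)//.
  by rewrite muB// muleC.
exact: realizes_invariant rB _ _.
Qed.

(** * The two factorizations and the isomorphism of factors *)

Unset Implicit Arguments.
Set Strict Implicit.

Theorem mainTheorem1
  (R : realType) (G H : groupType)
  (cG : countable [set: G]) (cH : countable [set: H])
  (* the standard probability space (X, mu) and the ergodic p.m.p. action (A,B) of G x H *)
  (d : measure_display) (X : measurableType d) (mu : probability X R)
  (stdX : standard_borel R X)
  (A : G -> X -> X) (B : H -> X -> X)
  (hAB : pmp_action2 mu A B) (ergAB : ergodic2 mu A B)
  (* ergodic decomposition of A: realization piA of E_A as a factor of (A,B);
     BA is the factor action E_{B acts on A} of H on (E_A, etaA) *)
  (dA : measure_display) (EA : measurableType dA) (etaA : probability EA R)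
  (stdEA : standard_borel R EA)
  (piA : X -> EA) (AA : G -> EA -> EA) (BA : H -> EA -> EA)
  (hA2 : pmp_action2 etaA AA BA)
  (fAA : factor_map mu A etaA AA piA) (fBA : factor_map mu B etaA BA piA)
  (rA : realizes mu (invariant_sets mu A) piA)
  (* ergodic decomposition of B: realization piB of E_B as a factor of (A,B);
     AB is the factor action E_{A acts on B} of G on (E_B, etaB) *)
  (dB : measure_display) (EB : measurableType dB) (etaB : probability EB R)
  (stdEB : standard_borel R EB)
  (piB : X -> EB) (AB : G -> EB -> EB) (BB : H -> EB -> EB)
  (hB2 : pmp_action2 etaB AB BB)
  (fAB : factor_map mu A etaB AB piB) (fBB : factor_map mu B etaB BB piB)
  (rB : realizes mu (invariant_sets mu B) piB)
  (* synergodic decomposition: realization Phi of sigma(E_A, E_B) as a factor of (A,B) *)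
  (dS : measure_display) (S : measurableType dS) (nuS : probability S R)
  (stdS : standard_borel R S)
  (Phi : X -> S) (CS : G -> S -> S) (DS : H -> S -> S)
  (hS2 : pmp_action2 nuS CS DS)
  (fCS : factor_map mu A nuS CS Phi) (fDS : factor_map mu B nuS DS Phi)
  (rS : realizes mu (<<s invariant_sets mu A `|` invariant_sets mu B >>) Phi) :
  (* it is isomorphic, as a factor, to the local product E_{A on B} [.] E_{B on A}
     on (E_B x E_A, etaB x etaA), with factor map x |-> (piB x, piA x) *)
  exists Psi : S -> EB * EA,
    action2_iso nuS CS DS ((etaB \x etaA)%E) (lprodG (Z:=EA) AB) (lprodH (Y:=EB) BA) Psi /\
    ae_eq_fun mu (Psi \o Phi) (fun x => (piB x, piA x)).

Proof.
have [actA actB _] := hAB; have [_ actBA _] := hA2.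
have [mA _ muA _] := fAA; have [mB _ muB _] := fAB; have [mPhi _ muPhi _] := fCS.
have Phi_mp : meas_pres mu nuS Phi by [].
pose Theta x := (piB x, piA x).
have Theta_mp : meas_pres mu (etaB \x etaA)%E Theta.
  exact: (synergodic_product_meas_pres cH actA actB ergAB actBA fBA rA).
have mTheta := Theta_mp.1.
(* [mu] has mass one, so [X] has a point; its images serve as default values of the
   factorizations. *)
have [x0 _] : [set: X] !=set0.
  apply/set0P; apply/negP => /eqP X0.
  have := probability_setT mu; rewrite X0 measure0 => /eqP.
  by rewrite eqe eq_sym oner_eq0.
pose SS := <<s invariant_sets mu A `|` invariant_sets mu B >>.
have mSS D : SS D -> measurable D.
  apply: smallest_sub D; first exact: sigma_algebra_measurable.
  by move=> D [] [].
(* Any factor realizing part of [SS] factors through [Phi], which realizes all of it. *)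
have psiP dZ (Z : measurableType dZ) (K : set (set X)) (pi : X -> Z) :
    standard_borel R Z -> measurable_fun setT pi -> realizes mu K pi ->
    K `<=` SS -> exists2 psi : S -> Z, measurable_fun setT psi &
      ae_eq_fun mu (psi \o Phi) pi.
  move=> stdZ mpi [_ rK] KSS; apply: (measurable_factor_ae (pi x0) stdZ) => E mE.
  have [D [KD DE]] := rK _ mE; have SD := KSS _ KD; have mD := mSS _ SD.
  have [F [mF DF]] := rS.1 _ SD; exists F => //.
  apply: ae_eq_set_trans (_ : ae_eq_set mu D _).
    by apply/ae_eq_set_sym/(ae_eq_setP mu mD (measurable_preimage mpi mE)).
  exact/(ae_eq_setP mu mD (measurable_preimage mPhi mF)).
have [psiA mpsiA psiAE] : exists2 psi : S -> EA, measurable_fun setT psi &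
    ae_eq_fun mu (psi \o Phi) piA.
  by apply: psiP rA _ => // D AD; apply: sub_sigma_algebra; left.
have [psiB mpsiB psiBE] : exists2 psi : S -> EB, measurable_fun setT psi &
    ae_eq_fun mu (psi \o Phi) piB.
  by apply: psiP rB _ => // D BD; apply: sub_sigma_algebra; right.
(* Conversely, [A]-invariant and [B]-invariant sets come from strips in [EB * EA], so all of [SS],
   and with it [Phi], comes from [Theta]. *)
have [Psi' mPsi' Psi'E] : exists2 psi : EB * EA -> S, measurable_fun setT psi &
    ae_eq_fun mu (psi \o Theta) Phi.
  apply: (measurable_factor_ae (Phi x0) stdS) => E mE.
  have [D [SD DE]] := rS.2 _ mE; have mD := mSS _ SD.
  have [|F mF DF] := @generated_sigma_algebra_ae_preimage _ _ _ _ _ mu Theta _ _ _ SD.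
    move=> {SD mD DE}D [DA|DB].
      have [F [mF DF]] := rA.1 _ DA; exists (setT `*` F); first exact: measurableX.
      move: DF => /(ae_eq_setP mu DA.1 (measurable_preimage mA mF)).
      by rewrite /ae_eq_set; apply: filterS => x ->; split => [|[]].
    have [F [mF DF]] := rB.1 _ DB; exists (F `*` setT); first exact: measurableX.
    move: DF => /(ae_eq_setP mu DB.1 (measurable_preimage mB mF)).
    by rewrite /ae_eq_set; apply: filterS => x ->; split => [|[]].
  exists F => //; apply: ae_eq_set_trans DF; apply: ae_eq_set_sym.
  exact/(ae_eq_setP mu mD (measurable_preimage mPhi mE)).
pose Psi s := (psiB s, psiA s).
have mPsi : measurable_fun setT Psi by exact: measurable_fun_pair.
have PsiE : ae_eq_fun mu (Psi \o Phi) Theta.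
  by move: psiAE psiBE; rewrite /ae_eq_fun /Psi /Theta; apply: filterS2 => x /= -> ->.
have Psi_mp := meas_pres_factor Phi_mp Theta_mp mPsi PsiE.
have Psi'_mp := meas_pres_factor Theta_mp Phi_mp mPsi' Psi'E.
exists Psi; split=> //; split => //.
(* Both composites become identities after precomposition with [Phi] or [Theta], and this descends
   to the factors. *)
- exists Psi'; split => //.
  + apply: (ae_eq_fun_meas_pres stdS Phi_mp) => //; first exact: measurableT_comp.
    by move: PsiE Psi'E; rewrite /ae_eq_fun; apply: filterS2 => x /= ->.
  + apply: (ae_eq_fun_meas_pres_pair stdEB stdEA Theta_mp) => //.
      exact: measurableT_comp.
    by move: Psi'E PsiE; rewrite /ae_eq_fun; apply: filterS2 => x /= ->.
- move=> g; have Ag := pmp_action_meas_pres actA g.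
  have [/(_ g)[mABg _] _ _] : pmp_action etaB AB by case: hB2.
  have [/(_ g)[mCS _] _ _] : pmp_action nuS CS by case: hS2.
  apply: (ae_eq_fun_meas_pres_pair stdEB stdEA Phi_mp).
  + exact: measurableT_comp.
  + by apply: measurable_fun_pair => //; exact: measurableT_comp.
  (* All sets pulled back from [EA] are [A]-invariant, so [A g] moves no fibre
     of [piA]. *)
  have piAg := invariant_ae_fun g stdEA actA mA rA.
  have [_ _ _ /(_ g) piBg] := fAB; have [_ _ _ /(_ g) Phig] := fCS.
  (* [PsiE] is used both at [x] and at [A g x]; the latter is legitimate since [A g] preserves
     [mu]. *)
  apply: filterS (filterI (filterI PsiE (ae_meas_pres Ag PsiE))
    (filterI piAg (filterI piBg Phig))) => x /= [[e1 e2] [e3 [e4 e5]]].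
  by rewrite -e5 e2 /lprodG e1 /Theta /= e3 e4.
- move=> h; have Bh := pmp_action_meas_pres actB h.
  have [/(_ h)[mBAh _] _ _] := actBA.
  have [/(_ h)[mDS _] _ _] : pmp_action nuS DS by case: hS2.
  apply: (ae_eq_fun_meas_pres_pair stdEB stdEA Phi_mp).
  + exact: measurableT_comp.
  + by apply: measurable_fun_pair => //; exact: measurableT_comp.
  (* Symmetrically, [B h] fixes the coordinate [piB] while [piA] is equivariant, which is why [H]
     moves only the factor [EA]. *)
  have piBh := invariant_ae_fun h stdEB actB mB rB.
  have [_ _ _ /(_ h) piAh] := fBA; have [_ _ _ /(_ h) Phih] := fDS.
  apply: filterS (filterI (filterI PsiE (ae_meas_pres Bh PsiE))
    (filterI piBh (filterI piAh Phih))) => x /= [[e1 e2] [e3 [e4 e5]]].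
  by rewrite -e5 e2 /lprodH e1 /Theta /= e3 e4.
Qed.
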